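(* Assume that for every $i=1,\dots,I$ there exists $\gamma_i>0$ such that $$\|F_i(U_1,U_2)-F_i(U_1^*,U_2^* )\|_{\mathcal H}\le \gamma_i\big(\|U_1-U_1^*\|_{\mathcal H}+\|U_2-U_2^*\|_{\mathcal H}\big)\qquad \forall\,(U_1,U_2),(U_1^*,U_2^* )\in\mathcal H\times\mathcal H ,$$ and that $F_i(0,0)=0$ for all $i=1,\dots,I$. Assume that $$\gamma:=\sum_{i=1}^I\gamma_i<\frac{\omega}{2M}.$$ If the time delay $\tau$ satisfies $$\tau<\tau_0:=\frac1\omega\ln\Big(\frac{\omega}{M\gamma}-1\Big),$$ then there exists $\omega'>0$ such that the solution $U\in C([0,+\infty),\mathcal H)$ of the problem $$U_t(t)=\mathcal A U(t)+\sum_{i=1}^I F_i(U(t),U(t-\tau_i))\ \text{ in }(0,+\infty),\qquad U(t-\tau)=U_0(t)\ \ \forall t\in(0,\tau],$$ with $U_0\in C([0,\tau];\mathcal H)$, satisfies $$\|U(t)\|_{\mathcal H}\le Me^{-\omega' t}\Big(\|U^0\|_{\mathcal H}+\sum_{i=1}^I\gamma_i\int_0^{\tau_i}e^{\omega s}\|U(s-\tau_i)\|_{\mathcal H}\,ds\Big)\qquad\forall t\ge0,$$ where $U^0:=U_0(\tau)$.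
   Context: $\mathcal H$ is a Hilbert space with norm $\|\cdot\|_{\mathcal H}$. $\mathcal A$ is an operator in $\mathcal H$ generating a $C_0$-semigroup $(S(t))_{t\ge0}$ that is exponentially stable: $M,\omega>0$ are constants with $\|S(t)\|_{\mathcal L(\mathcal H)}\le Me^{-\omega t}$ for all $t\ge0$. $I$ is a positive integer, $\tau_1,\dots,\tau_I>0$ are pairwise distinct time delays, with $\tau_i<\tau:=\tau_1$ for $i=2,\dots,I$, and $F_i:\mathcal H\times\mathcal H\to\mathcal H$. The initial condition means that $U(s)=U_0(s+\tau)$ for $s\in(-\tau,0]$. The solution is the (unique) mild one, i.e. $U(t)=S(t)U^0+\int_0^tS(t-s)\sum_{i=1}^IF_i(U(s),U(s-\tau_i))\,ds$ for $t\ge0$. *)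

(* Defs.v *)
From Stdlib Require Import Reals.
From Coquelicot Require Import Coquelicot.
Open Scope R_scope.

(** The scalars are real; a complex Hilbert space is covered by restricting
    scalars and taking the real part of its inner product. *)
Record is_inner_product {H : NormedModule R_AbsRing} (inner : H -> H -> R) : Prop :=
  { inner_sym : forall x y, inner x y = inner y x;
    inner_plus_l : forall x y z, inner (plus x y) z = inner x z + inner y z;
    inner_scal_l : forall (a : R) x y, inner (scal a x) y = a * inner x y;
    inner_pos : forall x, 0 <= inner x x;
    inner_def : forall x, inner x x = 0 -> x = zero }.

Definition is_hilbert (H : CompleteNormedModule R_AbsRing) : Prop :=
  exists inner : H -> H -> R,
    is_inner_product inner /\ forall x : H, norm x = sqrt (inner x x).

Definition op_norm {H : NormedModule R_AbsRing} (T : H -> H) : Rbar :=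
  Lub_Rbar (fun r => exists x : H, norm x <= 1 /\ r = norm (T x)).

(** [S] is only meaningful on [0, +oo); its values at negative times are
    unconstrained.  Coquelicot's [is_linear] includes boundedness. *)
Record is_C0_semigroup {H : NormedModule R_AbsRing} (S : R -> H -> H) : Prop :=
  { C0_linear : forall t, 0 <= t -> is_linear (S t);
    C0_zero : forall x, S 0 x = x;
    C0_plus : forall s t x, 0 <= s -> 0 <= t -> S (s + t) x = S s (S t x);
    C0_continuous : forall x, filterlim (fun t => S t x) (at_right 0) (locally x) }.

(** An unbounded operator is a domain [dom] together with a total function [A]
    whose values outside [dom] are irrelevant. *)
Definition is_generator {H : NormedModule R_AbsRing}
    (dom : H -> Prop) (A : H -> H) (S : R -> H -> H) : Prop :=
  forall x y : H,
    (dom x /\ A x = y) <->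
    filterlim (fun h => scal (/ h) (minus (S h x) x)) (at_right 0) (locally y).

Definition exp_stable {H : NormedModule R_AbsRing}
    (S : R -> H -> H) (M omega : R) : Prop :=
  forall t, 0 <= t -> Rbar_le (op_norm (S t)) (M * exp (- omega * t)).

(** Mild solution on [0, +oo) of
      U'(t) = A U(t) + sum_(1 <= i <= I) F_i (U(t), U(t - tau_i)),
      U(t - tau_1) = U0(t) for 0 < t <= tau_1,
    where [S] is the semigroup generated by A.  The value [U (- tau 1)], which
    the initial condition leaves free, enters the integrand only at [s = 0] and
    does not affect the integral. *)
Record is_mild_solution {H : NormedModule R_AbsRing} (S : R -> H -> H)
    (I : nat) (tau : nat -> R) (F : nat -> H -> H -> H)
    (U0 : R -> H) (U : R -> H) : Prop :=
  { mild_history : forall t, 0 < t <= tau 1%nat -> U (t - tau 1%nat) = U0 t;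
    mild_continuous : continuous_on (fun t => 0 <= t) U;
    mild_duhamel : forall t, 0 <= t ->
      exists J : H,
        is_RInt (fun s => S (t - s)
                   (sum_n_m (fun i => F i (U s) (U (s - tau i))) 1 I)) 0 t J /\
        U t = plus (S t (U0 (tau 1%nat))) J }.

(* Main.v *)
Require Import Defs.
From Stdlib Require Import Reals Lra Lia.
From Coquelicot Require Import Coquelicot.
Open Scope R_scope.

(** The theorem is a Gronwall estimate for [e^(omega t) |U t|].  The decay of
    the semigroup and the Lipschitz bound with [F i 0 0 = 0] turn Duhamel's
    formula, multiplied by [e^(omega t)], into
      [v t <= M (|U^0| + sum_i gamma_i int_0^t (v s + e^(omega s) |U (s - tau_i)|) ds)]
    with [v t = e^(omega t) |U t|].  Each delayed integral is at most its part
    over [0, tau_i], which only sees the history, plus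
    [e^(omega tau_i) int_0^t v], obtained by translating the rest by [tau_i]
    ([delayed_integral_le]).  As [tau_i <= tau], this yields
      [v t <= M C + K int_0^t v],   [K = M gamma (1 + e^(omega tau))],
    where [C] is the bracket of the conclusion.  Gronwall's lemma
    ([gronwall]) gives [v t <= M C e^(K t)], which is the conclusion for
    [omega' = omega - K]; the bound on [tau] is equivalent to [K < omega]
    ([growth_rate_lt]).

    Integrability of the norms along the solution comes from
    [mild_solution_norm_extension]: on (-tau, +oo) the map [t |-> |U t|]
    coincides with a function that is continuous on the whole line.  The
    point [-tau], where [U] is arbitrary, is met by the integrands only at an
    endpoint. *)

(** * Finite sums and integrals *)

Lemma sum_n_m_le_loc (a b : nat -> R) (n m : nat) :
  (forall i, (n <= i <= m)%nat -> a i <= b i) ->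
  sum_n_m a n m <= sum_n_m b n m.
Proof.
  induction m as [|m IH]; intros Hab.
  - destruct n as [|n].
    + rewrite !sum_n_n. apply Hab. lia.
    + rewrite !sum_n_m_zero by lia. apply Rle_refl.
  - destruct (Nat.le_gt_cases n (Datatypes.S m)) as [Hn|Hn].
    + rewrite !sum_n_Sm by exact Hn.
      apply Rplus_le_compat; [apply IH; intros i Hi|]; apply Hab; lia.
    + rewrite !sum_n_m_zero by lia. apply Rle_refl.
Qed.

Lemma sum_n_m_scal_plus (a b : nat -> R) (k : R) (n m : nat) :
  sum_n_m (fun i => k * (a i + b i)) n m = k * (sum_n_m a n m + sum_n_m b n m).
Proof.
  change (sum_n_m (fun i => mult k (plus (a i) (b i))) n m
          = mult k (plus (sum_n_m a n m) (sum_n_m b n m))).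
  now rewrite sum_n_m_mult_l, sum_n_m_plus.
Qed.

Lemma is_RInt_sum_n_m {V : NormedModule R_AbsRing} (f : nat -> R -> V)
    (l : nat -> V) (a b : R) (n m : nat) :
  (forall i, (n <= i <= m)%nat -> is_RInt (f i) a b (l i)) ->
  is_RInt (fun s => sum_n_m (fun i => f i s) n m) a b (sum_n_m l n m).
Proof.
  intros Hf.
  assert (Hempty : forall p, (p < n)%nat ->
    is_RInt (fun s => sum_n_m (fun i => f i s) n p) a b (sum_n_m l n p)).
  { intros p Hp. rewrite sum_n_m_zero by exact Hp.
    apply is_RInt_ext with (fun _ => zero).
    - intros x _. now rewrite sum_n_m_zero by exact Hp.
    - pose proof (is_RInt_const a b (zero : V)) as H0.
      rewrite (scal_zero_r (b - a) : scal (b - a) (zero : V) = zero) in H0.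
      exact H0. }
  induction m as [|m IH].
  - destruct n as [|n]; [|apply Hempty; lia].
    rewrite sum_n_n. apply is_RInt_ext with (f 0%nat).
    + intros x _. now rewrite sum_n_n.
    + apply Hf. lia.
  - destruct (Nat.le_gt_cases n (Datatypes.S m)) as [Hn|Hn];
      [|now apply Hempty].
    rewrite sum_n_Sm by exact Hn.
    apply is_RInt_ext
      with (fun s => plus (sum_n_m (fun i => f i s) n m) (f (Datatypes.S m) s)).
    + intros x _. now rewrite sum_n_Sm by exact Hn.
    + apply (is_RInt_plus (V := V)); [apply IH; intros i Hi|]; apply Hf; lia.
Qed.

(** The values at the endpoints do not influence the integrals, so the
    pointwise bound is only asked in the interior. *)
Lemma norm_RInt_le_interior {V : NormedModule R_AbsRing} (f : R -> V) (g : R -> R)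
    (a b : R) (lf : V) (lg : R) :
  a <= b -> (forall x, a < x < b -> norm (f x) <= g x) ->
  is_RInt f a b lf -> is_RInt g a b lg -> norm lf <= lg.
Proof.
  intros Hab Hfg Hf Hg.
  pose (inside := fun x => if Rlt_dec a x then if Rlt_dec x b then true else false
                           else false).
  assert (Hin : forall x, Rmin a b < x < Rmax a b -> inside x = true).
  { intros x. rewrite Rmin_left, Rmax_right by exact Hab. intros Hx.
    unfold inside. destruct (Rlt_dec a x), (Rlt_dec x b); lra || reflexivity. }
  apply (norm_RInt_le (fun x => if inside x then f x else zero)
                      (fun x => if inside x then g x else 0) a b); auto.
  - intros x _. unfold inside.
    destruct (Rlt_dec a x), (Rlt_dec x b);
      try (rewrite norm_zero; apply Rle_refl). apply Hfg; lra.
  - apply is_RInt_ext with f; auto. intros x Hx. now rewrite Hin.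
  - apply is_RInt_ext with g; auto. intros x Hx. now rewrite Hin.
Qed.

Lemma is_RInt_of_continuous (f : R -> R) (a b : R) :
  (forall x, continuous f x) -> is_RInt f a b (RInt f a b).
Proof.
  intros Hf. apply (RInt_correct (V := R_CompleteNormedModule)).
  apply (ex_RInt_continuous (V := R_CompleteNormedModule)). auto.
Qed.

(** * Gronwall and the delayed integral *)

(** The hypothesis makes [e^(-K t) (a + K int_0^t v)] nonincreasing; it starts
    at [a]. *)
Lemma gronwall (v : R -> R) (a K : R) :
  0 <= K -> (forall x, continuous v x) ->
  (forall t, 0 <= t -> v t <= a + K * RInt v 0 t) ->
  forall t, 0 <= t -> v t <= a * exp (K * t).
Proof.
  intros HK Hv Hle t Ht.
  assert (HP : exists P : R -> R,
    (forall x, is_derive P x (v x)) /\ P 0 = 0 /\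
    (forall x, 0 <= x -> v x <= a + K * P x)).
  { exists (fun x => RInt v 0 x). split; [|split; [|exact Hle]].
    - intros x. apply (is_derive_RInt (V := R_CompleteNormedModule) v _ 0 x); auto.
      apply filter_forall. intros y. now apply is_RInt_of_continuous.
    - apply (RInt_point (V := R_CompleteNormedModule)). }
  clear Hle. destruct HP as [P [HP [HP0 Hle]]].
  pose (q := fun x => exp (- K * x) * (a + K * P x)).
  pose (dq := fun x => exp (- K * x) * K * (v x - (a + K * P x))).
  assert (Hq : forall x, is_derive q x (dq x)).
  { intros x. unfold q, dq. auto_derive.
    - exists (v x). apply HP.
    - replace (Derive (fun y => P y) x) with (v x)
        by (symmetry; apply is_derive_unique, HP). ring. }
  assert (Hqt : q t <= q 0).
  { destruct (MVT_gen q 0 t dq) as [c [Hc Heq]].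
    - intros x _. apply Hq.
    - intros x _. apply continuity_pt_filterlim.
      apply (ex_derive_continuous (V := R_NormedModule) q). now exists (dq x).
    - rewrite Rmin_left, Rmax_right in Hc by exact Ht.
      assert (Hdq : dq c <= 0).
      { unfold dq. specialize (Hle c (proj1 Hc)).
        assert (0 <= exp (- K * c) * K)
          by (apply Rmult_le_pos; [apply Rlt_le, exp_pos|exact HK]). nra. }
      nra. }
  assert (Hq0 : q 0 = a).
  { unfold q. rewrite HP0, !Rmult_0_r, exp_0. ring. }
  rewrite Hq0 in Hqt. unfold q in Hqt.
  apply Rle_trans with (1 := Hle t Ht).
  apply Rmult_le_compat_r with (r := exp (K * t)) in Hqt;
    [|apply Rlt_le, exp_pos].
  replace (exp (- K * t) * (a + K * P t) * exp (K * t))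
    with (exp (- K * t) * exp (K * t) * (a + K * P t)) in Hqt by ring.
  rewrite <- exp_plus in Hqt. replace (- K * t + K * t) with 0 in Hqt by ring.
  rewrite exp_0 in Hqt. lra.
Qed.

Lemma continuous_exp_weight (omega h : R) (w : R -> R) :
  (forall x, continuous w x) ->
  forall x, continuous (fun s => exp (omega * s) * w (s - h)) x.
Proof.
  intros Hw x. apply (continuous_mult (K := R_AbsRing)).
  - apply (ex_derive_continuous (V := R_NormedModule)). now auto_derive.
  - apply (continuous_comp (fun s => s - h) w); [|apply Hw].
    apply (ex_derive_continuous (V := R_NormedModule)). now auto_derive.
Qed.

(** The integrand is nonnegative, so the interval may be enlarged to
    [0, t + h]; cutting it at [h] and translating the second piece to [0, t]
    avoids comparing [t] with [h]. *)
Lemma delayed_integral_le (omega h t : R) (w : R -> R) :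
  0 <= h -> 0 <= t -> (forall x, continuous w x) -> (forall x, 0 <= w x) ->
  RInt (fun s => exp (omega * s) * w (s - h)) 0 t
  <= RInt (fun s => exp (omega * s) * w (s - h)) 0 h
     + exp (omega * h) * RInt (fun s => exp (omega * s) * w s) 0 t.
Proof.
  intros Hh Ht Hw Hpos.
  set (f := fun s => exp (omega * s) * w (s - h)).
  set (v := fun s => exp (omega * s) * w s).
  assert (Hf : forall a b, is_RInt f a b (RInt f a b)).
  { intros a b. now apply is_RInt_of_continuous, continuous_exp_weight. }
  assert (Hfpos : forall x, 0 <= f x).
  { intros x. apply Rmult_le_pos; [apply Rlt_le, exp_pos|apply Hpos]. }
  assert (Hsplit : forall a b c, RInt f a b + RInt f b c = RInt f a c).
  { intros a b c. apply (RInt_Chasles (V := R_CompleteNormedModule) f);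
      eexists; apply Hf. }
  assert (Htail : 0 <= RInt f t (t + h)).
  { apply RInt_ge_0; [lra|eexists; apply Hf|auto]. }
  assert (Hshift : RInt f h (t + h) = exp (omega * h) * RInt v 0 t).
  { transitivity (RInt (fun s => f (s + h)) 0 t).
    - symmetry. etransitivity; [|etransitivity;
        [apply (RInt_comp_lin (V := R_CompleteNormedModule) f 1 h 0 t);
         eexists; apply Hf|]].
      + apply RInt_ext. intros x _. change (f (x + h) = 1 * f (1 * x + h)).
        now rewrite !Rmult_1_l.
      + f_equal; ring.
    - rewrite (RInt_ext _ (fun s => scal (exp (omega * h)) (v s))).
      + apply (RInt_scal (V := R_CompleteNormedModule)).
        apply (ex_RInt_continuous (V := R_CompleteNormedModule)). intros x _.
        apply continuous_ext with (fun s => exp (omega * s) * w (s - 0)).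
        * intros s. unfold v. now rewrite Rminus_0_r.
        * now apply continuous_exp_weight.
      + intros x _. unfold f, v.
        replace (x + h - h) with x by ring.
        rewrite Rmult_plus_distr_l, exp_plus.
        change (exp (omega * x) * exp (omega * h) * w x
                = exp (omega * h) * (exp (omega * x) * w x)). ring. }
  rewrite <- Hshift, (Hsplit 0 h (t + h)), <- (Hsplit 0 t (t + h)). lra.
Qed.

(** * Semigroup decay and regularity of the solution *)

(** The operator norm only sees the unit ball; linearity carries the bound to
    all vectors. *)
Lemma exp_stable_norm_le {H : NormedModule R_AbsRing} (S : R -> H -> H)
    (M omega : R) :
  is_C0_semigroup S -> exp_stable S M omega ->
  forall t x, 0 <= t -> norm (S t x) <= M * exp (- omega * t) * norm x.
Proof.
  intros HS Hst t x Ht.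
  pose proof (C0_linear _ HS t Ht) as Hlin.
  destruct (Rle_lt_or_eq_dec 0 (norm x) (norm_ge_0 x)) as [Hx|Hx].
  - specialize (Hst t Ht). unfold op_norm in Hst.
    set (E := fun r => exists x0 : H, norm x0 <= 1 /\ r = norm (S t x0)) in Hst.
    assert (Hunit : norm (S t (scal (/ norm x) x)) <= M * exp (- omega * t)).
    { assert (HE : E (norm (S t (scal (/ norm x) x)))).
      { eexists. split; [|reflexivity].
        apply Rle_trans with (1 := norm_scal (K := R_AbsRing) (V := H) _ _).
        change (abs (/ norm x)) with (Rabs (/ norm x)).
        rewrite Rabs_pos_eq by (apply Rlt_le, Rinv_0_lt_compat, Hx).
        rewrite Rinv_l by lra. apply Rle_refl. }
      apply (Rbar_le_trans (Finite _) (Lub_Rbar E) (Finite _)); [|exact Hst].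
      now apply (proj1 (Lub_Rbar_correct E)). }
    replace x with (scal (norm x) (scal (/ norm x) x)) at 1.
    + rewrite (linear_scal _ Hlin).
      apply Rle_trans with (1 := norm_scal (K := R_AbsRing) (V := H) _ _).
      change (abs (norm x)) with (Rabs (norm x)).
      rewrite Rabs_pos_eq by lra. nra.
    + rewrite scal_assoc. change (mult (norm x) (/ norm x)) with (norm x * / norm x).
      rewrite Rinv_r by lra. apply (scal_one (V := NormedModule.ModuleSpace _ H)).
  - symmetry in Hx. rewrite Hx. apply norm_eq_zero in Hx. rewrite Hx.
    rewrite (linear_zero _ Hlin), norm_zero. lra.
Qed.

Lemma continuous_on_comp {U V : UniformSpace} (D : U -> Prop) (f : U -> V)
    (c : R -> U) (x : R) :
  continuous_on D f -> (forall y, D (c y)) -> continuous c x ->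
  continuous (fun y => f (c y)) x.
Proof.
  intros Hf HD Hc. apply (filterlim_comp _ _ _ c f _ (within D (locally (c x)))).
  - intros P HP. change (locally x (fun y => P (c y))).
    apply (filter_imp (fun y => D (c y) -> P (c y))).
    + intros y Hy. apply Hy, HD.
    + exact (Hc _ HP).
  - apply Hf, HD.
Qed.

Lemma continuous_pos_part (f : R -> R) (x : R) :
  continuous f x -> continuous (fun y => Rmax 0 (f y)) x.
Proof.
  intros Hf. apply (continuous_comp f (Rmax 0) x Hf).
  apply (continuous_ext (fun y => (y + Rabs y) / 2)).
  - intros y. destruct (Rle_dec 0 y).
    + rewrite Rabs_pos_eq, Rmax_right by lra. lra.
    + rewrite Rabs_left, Rmax_left by lra. lra.
  - apply continuity_pt_filterlim. reg.
Qed.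

(** Clamping the arguments of the history and of the solution to their domains
    makes both continuous on the line; where one of them is active the other is
    frozen at the common value [U0 (tau 1) = U 0], so their sum minus that value
    glues the two norms without a case distinction. *)
Lemma mild_solution_norm_extension {H : NormedModule R_AbsRing} (S : R -> H -> H)
    (I : nat) (tau : nat -> R) (F : nat -> H -> H -> H) (U0 U : R -> H) :
  0 < tau 1%nat ->
  continuous_on (fun t => 0 <= t <= tau 1%nat) U0 ->
  is_mild_solution S I tau F U0 U ->
  exists w : R -> R,
    (forall x, continuous w x) /\ (forall x, 0 <= w x) /\
    (forall x, - tau 1%nat < x -> w x = norm (U x)).
Proof.
  intros Htau HU0 [Hhist HU _].
  set (T := tau 1%nat) in *.
  assert (HU00 : U 0 = U0 T).
  { rewrite <- (Hhist T) by lra. f_equal. ring. }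
  pose (past := fun s => norm (U0 (Rmax 0 (T - Rmax 0 (- s))))).
  pose (future := fun s => norm (U (Rmax 0 s))).
  exists (fun s => past s + future s - norm (U0 T)). repeat split.
  - intros x.
    apply (continuous_minus (V := R_NormedModule)); [|apply continuous_const].
    apply (continuous_plus (V := R_NormedModule)).
    + apply (continuous_comp (fun s => U0 (Rmax 0 (T - Rmax 0 (- s)))) norm);
        [|apply filterlim_norm].
      apply (continuous_on_comp (fun t => 0 <= t <= T) U0); [exact HU0| |].
      * intros y. split; [apply Rmax_l|].
        pose proof (Rmax_l 0 (- y)). apply Rmax_lub; lra.
      * apply continuous_pos_part.
        apply (continuous_minus (V := R_NormedModule));
          [apply continuous_const|].
        apply continuous_pos_part.
        apply (continuous_opp (V := R_NormedModule)), continuous_id.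
    + apply (continuous_comp (fun s => U (Rmax 0 s)) norm);
        [|apply filterlim_norm].
      apply (continuous_on_comp (fun t => 0 <= t) U); [exact HU| |].
      * intros y. apply Rmax_l.
      * apply continuous_pos_part, continuous_id.
  - intros x. unfold past, future. destruct (Rle_dec 0 x) as [Hx|Hx].
    + rewrite (Rmax_left 0 (- x)), Rminus_0_r, (Rmax_right 0 T) by lra.
      pose proof (norm_ge_0 (U (Rmax 0 x))). lra.
    + rewrite (Rmax_left 0 x), HU00 by lra.
      pose proof (norm_ge_0 (U0 (Rmax 0 (T - Rmax 0 (- x))))). lra.
  - intros x HxT. unfold past, future. destruct (Rle_dec 0 x) as [Hx|Hx].
    + rewrite (Rmax_left 0 (- x)), Rminus_0_r, (Rmax_right 0 T),
        (Rmax_right 0 x) by lra. lra.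
    + rewrite (Rmax_left 0 x), HU00 by lra.
      rewrite (Rmax_right 0 (- x)), Rmax_right by lra.
      rewrite <- (Hhist (T - - x)) by lra.
      replace (T - - x - T) with x by ring. lra.
Qed.

(** * The decay rate *)

Lemma growth_rate_lt (M omega gam T : R) :
  0 < M -> 0 < omega -> 0 < gam -> gam < omega / (2 * M) ->
  T < 1 / omega * ln (omega / (M * gam) - 1) ->
  M * gam * (1 + exp (omega * T)) < omega.
Proof.
  intros HM Ho Hg Hsmall HT.
  assert (HMg : 0 < M * gam) by now apply Rmult_lt_0_compat.
  assert (H2 : 2 * (M * gam) < omega).
  { apply (Rmult_lt_compat_r (2 * M)) in Hsmall; [|lra].
    replace (omega / (2 * M) * (2 * M)) with omega in Hsmall by (field; lra). lra. }
  (* The smallness of gam keeps the logarithm away from its junk values. *)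
  assert (Harg : 0 < omega / (M * gam) - 1).
  { apply (Rmult_lt_reg_r (M * gam)); [exact HMg|].
    replace ((omega / (M * gam) - 1) * (M * gam)) with (omega - M * gam)
      by (field; lra). lra. }
  assert (Hexp : exp (omega * T) < omega / (M * gam) - 1).
  { rewrite <- (exp_ln _ Harg) at 1. apply exp_increasing.
    apply (Rmult_lt_compat_l omega) in HT; [|exact Ho].
    replace (omega * (1 / omega * ln (omega / (M * gam) - 1)))
      with (ln (omega / (M * gam) - 1)) in HT by (field; lra). exact HT. }
  apply (Rmult_lt_compat_l (M * gam)) in Hexp; [|exact HMg].
  replace (M * gam * (omega / (M * gam) - 1)) with (omega - M * gam) in Hexp
    by (field; lra). lra.
Qed.

Theorem theorem2p2
  (H : CompleteNormedModule R_AbsRing) (H_hilbert : is_hilbert H)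
  (domA : H -> Prop) (A : H -> H) (S : R -> H -> H)
  (S_semigroup : is_C0_semigroup S) (A_generates_S : is_generator domA A S)
  (M omega : R) (M_pos : 0 < M) (omega_pos : 0 < omega)
  (S_stable : exp_stable S M omega)
  (I : nat) (I_pos : (1 <= I)%nat)
  (tau : nat -> R)
  (tau_pos : forall i, (1 <= i <= I)%nat -> 0 < tau i)
  (tau_distinct : forall i j, (1 <= i <= I)%nat -> (1 <= j <= I)%nat ->
     i <> j -> tau i <> tau j)
  (tau_lt : forall i, (2 <= i <= I)%nat -> tau i < tau 1%nat)
  (F : nat -> H -> H -> H)
  (gamma : nat -> R)
  (gamma_pos : forall i, (1 <= i <= I)%nat -> 0 < gamma i)
  (F_lipschitz : forall i, (1 <= i <= I)%nat -> forall U1 U2 V1 V2 : H,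
     norm (minus (F i U1 U2) (F i V1 V2))
     <= gamma i * (norm (minus U1 V1) + norm (minus U2 V2)))
  (F_zero : forall i, (1 <= i <= I)%nat -> F i zero zero = zero)
  (gamma_small : sum_n_m gamma 1 I < omega / (2 * M))
  (tau_small :
     tau 1%nat < 1 / omega * ln (omega / (M * sum_n_m gamma 1 I) - 1)) :
  exists omega' : R, 0 < omega' /\
    forall U0 U : R -> H,
      continuous_on (fun t => 0 <= t <= tau 1%nat) U0 ->
      is_mild_solution S I tau F U0 U ->
      forall t, 0 <= t ->
        norm (U t) <=
          M * exp (- omega' * t) *
          (norm (U0 (tau 1%nat)) +
           sum_n_m (fun i => gamma i *
             RInt (fun s => exp (omega * s) * norm (U (s - tau i))) 0 (tau i)) 1 I).
Proof.
  set (T := tau 1%nat) in *. set (gam := sum_n_m gamma 1 I) in *.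
  assert (T_pos : 0 < T) by (apply tau_pos; lia).
  assert (tau_le : forall i, (1 <= i <= I)%nat -> tau i <= T).
  { intros i Hi. destruct (Nat.eq_dec i 1) as [->|Hi1]; [apply Rle_refl|].
    apply Rlt_le, tau_lt. lia. }
  assert (gam_pos : 0 < gam).
  { unfold gam. rewrite sum_Sn_m by exact I_pos.
    change (0 < gamma 1%nat + sum_n_m gamma 2 I).
    assert (0 < gamma 1%nat) by (apply gamma_pos; lia).
    assert (sum_n_m (fun _ => 0) 2 I <= sum_n_m gamma 2 I).
    { apply sum_n_m_le_loc. intros i Hi. apply Rlt_le, gamma_pos. lia. }
    rewrite sum_n_m_const, Rmult_0_r in *. lra. }
  set (K := M * gam * (1 + exp (omega * T))).
  assert (K_lt : K < omega) by (apply growth_rate_lt; assumption).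
  assert (K_pos : 0 <= K).
  { unfold K. pose proof (exp_pos (omega * T)).
    apply Rmult_le_pos; [apply Rmult_le_pos|]; lra. }
  exists (omega - K). split; [lra|].
  intros U0 U HU0 Hmild.
  destruct (mild_solution_norm_extension S I tau F U0 U T_pos HU0 Hmild)
    as [w [w_cont [w_pos w_eq]]].
  fold T in w_eq |- *.
  set (C := fun i => RInt (fun s => exp (omega * s) * w (s - tau i)) 0 (tau i)).
  rewrite (sum_n_m_ext_loc _ (fun i => gamma i * C i)).
  (* For i = 1 the two integrands may differ at s = 0, where U (- tau 1) is
     arbitrary. *)
  2:{ intros i Hi. unfold C. f_equal. apply RInt_ext. intros s.
      pose proof (tau_pos i Hi). pose proof (tau_le i Hi).
      rewrite Rmin_left, Rmax_right by lra. intros Hs.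
      now rewrite w_eq by lra. }
  set (hist := norm (U0 T) + sum_n_m (fun i => gamma i * C i) 1 I).
  set (v := fun s => exp (omega * s) * w s).
  assert (v_cont : forall x, continuous v x).
  { intros x. apply continuous_ext with (fun s => exp (omega * s) * w (s - 0)).
    - intros s. unfold v. now rewrite Rminus_0_r.
    - now apply continuous_exp_weight. }
  assert (v_int : forall t, 0 <= t -> v t <= M * hist + K * RInt v 0 t).
  { intros t Ht.
    destruct (mild_duhamel _ _ _ _ _ _ Hmild t Ht) as [J [HJ HUt]].
    fold T in HUt.
    set (Q := fun i => RInt (fun s => exp (omega * s) * w (s - tau i)) 0 t).
    set (k := M * exp (- omega * t)).
    assert (k_pos : 0 <= k)
      by (unfold k; pose proof (exp_pos (- omega * t)); nra).
    (* k carries the decay e^(-omega t) out of the integral: for s in (0, t),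
       the bound M e^(-omega (t - s)) is k e^(omega s). *)
    assert (HJle : norm J <=
              sum_n_m (fun i => k * (gamma i * (RInt v 0 t + Q i))) 1 I).
    { refine (norm_RInt_le_interior _
        (fun s => sum_n_m (fun i => k * (gamma i *
           (v s + exp (omega * s) * w (s - tau i)))) 1 I) 0 t _ _ Ht _ HJ _).
      - intros s Hs.
        apply Rle_trans with (1 := exp_stable_norm_le S M omega S_semigroup
          S_stable (t - s) _ ltac:(lra)).
        replace (M * exp (- omega * (t - s))) with (k * exp (omega * s))
          by (unfold k; rewrite Rmult_assoc, <- exp_plus; f_equal; f_equal; ring).
        apply Rle_trans with (k * exp (omega * s)
          * sum_n_m (fun i => gamma i * (w s + w (s - tau i))) 1 I).
        + apply Rmult_le_compat_l;
            [apply Rmult_le_pos; [exact k_pos|apply Rlt_le, exp_pos]|].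
          apply Rle_trans with (1 := norm_sum_n_m _ _ _).
          apply sum_n_m_le_loc. intros i Hi.
          pose proof (tau_pos i Hi). pose proof (tau_le i Hi).
          rewrite !w_eq by lra.
          pose proof (F_lipschitz i Hi (U s) (U (s - tau i)) zero zero) as HF.
          rewrite F_zero in HF by exact Hi.
          assert (Hminus : forall x : H, minus x zero = x)
            by (intros x; apply minus_zero_r).
          rewrite !Hminus in HF. exact HF.
        + change (k * exp (omega * s)
            * sum_n_m (fun i => gamma i * (w s + w (s - tau i))) 1 I) with
            (mult (k * exp (omega * s))
             (sum_n_m (fun i => gamma i * (w s + w (s - tau i))) 1 I)).
          rewrite <- (sum_n_m_mult_l (K := R_Ring)).
          apply Req_le, sum_n_m_ext. intros i. unfold v.
          change (k * exp (omega * s) * (gamma i * (w s + w (s - tau i))) =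
            k * (gamma i * (exp (omega * s) * w s
                            + exp (omega * s) * w (s - tau i)))). ring.
      - apply (is_RInt_sum_n_m (V := R_NormedModule)). intros i _.
        apply (is_RInt_scal (V := R_NormedModule)
                 (fun s => gamma i * (v s + exp (omega * s) * w (s - tau i)))).
        apply (is_RInt_scal (V := R_NormedModule)
                 (fun s => v s + exp (omega * s) * w (s - tau i))).
        apply (is_RInt_plus (V := R_NormedModule) v);
          apply is_RInt_of_continuous; [exact v_cont|].
        now apply continuous_exp_weight. }
    assert (HJle' : norm J <=
      k * (sum_n_m (fun i => gamma i * C i) 1 I
           + gam * ((1 + exp (omega * T)) * RInt v 0 t))).
    { apply Rle_trans with (1 := HJle).
      replace (gam * ((1 + exp (omega * T)) * RInt v 0 t)) with
        (sum_n_m (fun i => gamma i * ((1 + exp (omega * T)) * RInt v 0 t)) 1 I)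
        by apply (sum_n_m_mult_r (K := R_Ring)).
      rewrite <- sum_n_m_scal_plus.
      apply sum_n_m_le_loc. intros i Hi.
      apply Rmult_le_compat_l; [exact k_pos|].
      rewrite <- Rmult_plus_distr_l.
      apply Rmult_le_compat_l; [apply Rlt_le, gamma_pos, Hi|].
      pose proof (tau_pos i Hi) as Hi0. pose proof (tau_le i Hi) as HiT.
      pose proof (delayed_integral_le omega (tau i) t w (Rlt_le _ _ Hi0) Ht
                    w_cont w_pos) as HQ.
      fold v in HQ. fold (Q i) in HQ. fold (C i) in HQ.
      assert (Hv0 : 0 <= RInt v 0 t).
      { apply RInt_ge_0; [exact Ht|eexists; now apply is_RInt_of_continuous|].
        intros x _. apply Rmult_le_pos; [apply Rlt_le, exp_pos|apply w_pos]. }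
      assert (Hexp : exp (omega * tau i) <= exp (omega * T)).
      { destruct (Rle_lt_or_eq_dec _ _ HiT) as [Hlt| ->]; [|apply Rle_refl].
        apply Rlt_le, exp_increasing. now apply Rmult_lt_compat_l. }
      nra. }
    assert (HUle : norm (U t) <= k * (hist + gam * ((1 + exp (omega * T)) * RInt v 0 t))).
    { rewrite HUt. apply Rle_trans with (1 := norm_triangle _ _).
      pose proof (exp_stable_norm_le S M omega S_semigroup S_stable t (U0 T) Ht)
        as HS0. fold k in HS0. unfold hist. lra. }
    unfold v at 1. rewrite w_eq by lra.
    apply (Rmult_le_compat_l (exp (omega * t))) in HUle;
      [|apply Rlt_le, exp_pos].
    apply Rle_trans with (1 := HUle), Req_le.
    replace (exp (omega * t) * (k * (hist + gam * ((1 + exp (omega * T)) * RInt v 0 t))))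
      with (exp (omega * t) * exp (- omega * t)
            * (M * (hist + gam * ((1 + exp (omega * T)) * RInt v 0 t))))
      by (unfold k; ring).
    rewrite <- exp_plus. replace (omega * t + - omega * t) with 0 by ring.
    rewrite exp_0. unfold K. ring. }
  intros t Ht.
  pose proof (gronwall v (M * hist) K K_pos v_cont v_int t Ht) as Hv.
  unfold v in Hv. rewrite w_eq in Hv by lra.
  apply (Rmult_le_compat_l (exp (- omega * t))) in Hv; [|apply Rlt_le, exp_pos].
  rewrite <- Rmult_assoc, <- exp_plus in Hv.
  replace (- omega * t + omega * t) with 0 in Hv by ring.
  rewrite exp_0, Rmult_1_l in Hv.
  apply Rle_trans with (1 := Hv), Req_le.
  replace (- (omega - K) * t) with (- omega * t + K * t) by ring.
  rewrite exp_plus. ring.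
Qed.
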